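(* Let $A \in \mathbb{R}^{m\times m}$, $b\in\mathbb{R}^m$ and $V = \mathcal{C}(A,b)$ be such that $\operatorname{rank}(V) = r$ and $V \in \mathrm{SC}_r$. Let $$W_k := K_r^{\mathsf T} V_{(:,(1:r))}^\dagger V_{(:,\{r+k\})} \in \mathbb{R}^r, \quad k \geq 1.$$ Then the sequences $\{g_{(i)}(k)\}_{k\geq 1}$, $i \in \{1,\dots,r\}$, and $\{p(k)\}_{k\geq 1}$ defined by $$g_{(i)}(k) := W_k^{\mathsf T} e_i \quad\text{and}\quad p(k) := \sum_{i=1}^r g_{(i)}(k) = W_k^{\mathsf T}\mathbf{1}_r = \|V_{(:,(1:r))}^\dagger V_{(:,\{r+k\})}\|_{\ell_1}$$ are log-concave (the last equality, with the $\ell_1$-norm, being part of the claim).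
   Context: For $A\in\mathbb{R}^{m\times m}$, $b\in\mathbb{R}^m$, $\mathcal{C}^N(A,b) = [\, b \;\; Ab \;\; \cdots \;\; A^{N-1}b \,] \in \mathbb{R}^{m\times N}$, and $\mathcal{C}(A,b) = [\, b \;\; Ab \;\; A^2 b\;\; \cdots\,]$ has countably infinitely many columns. A finite matrix $X$ is called $k$-sign consistent ($X \in \mathrm{SC}_k$) if all its minors of order $k$ are $\geq 0$ or all its minors of order $k$ are $\leq 0$. $\mathcal{C}(A,b)\in \mathrm{SC}_k$ means that $\mathcal{C}^N(A,b) \in \mathrm{SC}_k$ for all $N\geq k$. $V_{(:,(1:r))}$ denotes the first $r$ columns of $V$ and $V_{(:,\{i\})}$ its $i$-th column. $X^\dagger$ is the Moore–Penrose inverse. $K_r\in\mathbb{R}^{r\times r}$ is the anti-diagonal matrix with $(i,j)$ entry $(-1)^{j-1}$ if $i+j = r+1$ and $0$ otherwise. $e_i$ is the $i$-th canonical unit vector and $\mathbf{1}_r\in\mathbb{R}^r$ the all-ones vector; $\|x\|_{\ell_1} = \sum_i|x_i|$. A sequence $\{a_k\}_{k\geq 1}$ of real numbers is log-concave if $a_k\geq 0$ for all $k$ and $a_{k+1}^2 \geq a_k a_{k+2}$ for all $k \geq 1$. *)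

(* Defs.v *)
From mathcomp Require Import all_boot all_order all_algebra.

Set Implicit Arguments.
Unset Strict Implicit.
Unset Printing Implicit Defensive.

Import Order.TTheory GRing.Theory Num.Theory.
Local Open Scope ring_scope.

(** A matrix with [m] rows and countably many columns is the sequence of its
    columns, numbered from 0: column [j] in 1-based numbering is [X j.-1]. *)
Definition infmx (R : realFieldType) (m : nat) := nat -> 'cV[R]_m.

Definition first_cols (R : realFieldType) (m N : nat) (X : infmx R m) :
    'M[R]_(m, N) :=
  \matrix_(i < m, j < N) X j i 0.

(** [infrank_eq X r]: the linear span of the columns of [X] has dimension [r]. *)
Definition infrank_eq (R : realFieldType) (m : nat) (X : infmx R m) (r : nat) :
    Prop :=
  exists U : {vspace 'cV[R]_m},
    [/\ forall j, X j \in U,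
        forall U' : {vspace 'cV[R]_m}, (forall j, X j \in U') -> (U <= U')%VS
      & \dim U = r].

(** The finite matrix C^N(A,b) is [first_cols N (ctrb A b)]. *)
Definition ctrb (R : realFieldType) (m : nat) (A : 'M[R]_m) (b : 'cV[R]_m) :
    infmx R m :=
  fun j => A ^+ j *m b.

Definition increasing_ord (k n : nat) (f : 'I_k -> 'I_n) : Prop :=
  forall i j : 'I_k, (i < j)%N -> (f i < f j)%N.

Definition sign_consistent (R : realFieldType) (m n k : nat)
    (X : 'M[R]_(m, n)) : Prop :=
  (forall (f : 'I_k -> 'I_m) (g : 'I_k -> 'I_n),
     increasing_ord f -> increasing_ord g -> 0 <= \det (mxsub f g X)) \/
  (forall (f : 'I_k -> 'I_m) (g : 'I_k -> 'I_n),
     increasing_ord f -> increasing_ord g -> \det (mxsub f g X) <= 0).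

Definition inf_sign_consistent (R : realFieldType) (m k : nat)
    (X : infmx R m) : Prop :=
  forall N, (k <= N)%N -> sign_consistent k (first_cols N X).

(** With 0-based indices, i + j = r + 1 reads [(i + j).+1 = r], and the sign
    exponent j - 1 is [j]. *)
Definition Kmx (R : realFieldType) (r : nat) : 'M[R]_r :=
  \matrix_(i < r, j < r) (if (i + j).+1 == r then (-1) ^+ j else 0).

Definition l1norm (R : realFieldType) (n : nat) (x : 'cV[R]_n) : R :=
  \sum_(i < n) `|x i 0|.

(** Sequences indexed from 1; the value at 0 is irrelevant. *)
Definition log_concave (R : realFieldType) (a : nat -> R) : Prop :=
  (forall k, (1 <= k)%N -> 0 <= a k) /\
  (forall k, (1 <= k)%N -> a k * a k.+2 <= a k.+1 ^+ 2).

Definition penrose (R : realFieldType) (m n : nat)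
    (X : 'M[R]_(m, n)) (Y : 'M[R]_(n, m)) : bool :=
  [&& X *m Y *m X == X, Y *m X *m Y == Y,
      (X *m Y)^T == X *m Y & (Y *m X)^T == Y *m X].

Lemma gram_unit (R : realFieldType) (k n : nat) (B : 'M[R]_(k, n)) :
  row_free B -> B *m B^T \in unitmx.
Proof.
move=> freeB; rewrite -row_free_unit -kermx_eq0; apply/eqP/row_matrixP => i.
rewrite row0; set v := row i _.
have /sub_kermxP vBB : (v <= kermx (B *m B^T))%MS by apply: row_sub.
have vB0 : v *m B = 0.
  have : (v *m B) *m (v *m B)^T = 0.
    by rewrite trmx_mul mulmxA -(mulmxA v) vBB mul0mx.
  move/matrixP/(_ 0 0); rewrite !mxE => /eqP.
  rewrite psumr_eq0 => [/allP sq0|j _]; last by rewrite !mxE -expr2 sqr_ge0.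
  apply/rowP => j; have := sq0 j (mem_index_enum j).
  by rewrite /= [_^T _ _]mxE mulf_eq0 orbb [RHS]mxE => /eqP.
by apply: (row_free_inj freeB); rewrite vB0 mul0mx.
Qed.

Lemma penrose_exists (R : realFieldType) (m n : nat) (X : 'M[R]_(m, n)) :
  exists Y, penrose X Y.
Proof.
have [k [C [F [fullC freeF X_CF]]]] : exists k (C : 'M[R]_(m, k)) (F : 'M[R]_(k, n)),
    [/\ row_full C, row_free F & X = C *m F].
  exists (\rank X), (col_base X), (row_base X).
  by rewrite col_base_full row_base_free mulmx_base.
set P := F *m F^T; set Q := C^T *m C.
have Pu : P \in unitmx by apply: gram_unit.
have Qu : Q \in unitmx.
  have -> : Q = C^T *m C^T^T by rewrite trmxK.
  apply: gram_unit.
  by rewrite /row_free mxrank_tr.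
have Pt : P^T = P by rewrite trmx_mul trmxK.
have Qt : Q^T = Q by rewrite trmx_mul trmxK.
pose Y := F^T *m invmx P *m invmx Q *m C^T.
have XY : X *m Y = C *m invmx Q *m C^T.
  by rewrite X_CF /Y !mulmxA -(mulmxA C F) -/P mulmxK.
have YX : Y *m X = F^T *m invmx P *m F.
  by rewrite X_CF /Y !mulmxA -(mulmxA _ C^T C) -/Q mulmxKV.
exists Y; apply/and4P; split; apply/eqP.
- by rewrite XY X_CF !mulmxA -(mulmxA _ C^T C) -/Q mulmxKV.
- by rewrite YX /Y !mulmxA -(mulmxA _ F F^T) -/P mulmxKV.
- by rewrite XY !trmx_mul trmxK trmx_inv Qt mulmxA.
- by rewrite YX !trmx_mul trmxK trmx_inv Pt mulmxA.
Qed.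

(** The Moore-Penrose inverse: the unique solution of the four Penrose
    equations. *)
Definition mppinv (R : realFieldType) (m n : nat) (X : 'M[R]_(m, n)) :
    'M[R]_(n, m) :=
  xchoose (penrose_exists X).

Lemma mppinvP (R : realFieldType) (m n : nat) (X : 'M[R]_(m, n)) :
  penrose X (mppinv X).
Proof. exact: xchooseP. Qed.

Lemma penrose_unique (R : realFieldType) (m n : nat) (X : 'M[R]_(m, n)) Y Z :
  penrose X Y -> penrose X Z -> Y = Z.
Proof.
move=> /and4P[/eqP XYX /eqP YXY /eqP XYt /eqP YXt].
move=> /and4P[/eqP XZX /eqP ZXZ /eqP XZt /eqP ZXt].
have XYZ : X *m Y = X *m Z.
  by rewrite -XYt -[in LHS]XZX -(mulmxA (X *m Z)) trmx_mul XYt XZt mulmxA XYX.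
have YZX : Y *m X = Z *m X.
  rewrite -YXt -[in LHS]XZX -(mulmxA X) mulmxA trmx_mul YXt ZXt.
  by rewrite -!mulmxA (mulmxA X) XYX.
by rewrite -YXY -mulmxA XYZ mulmxA YZX ZXZ.
Qed.

(* Main.v *)
(** The first [r] columns of [V] form a basis of its column space, and in the
    coordinates [x] of that basis sign consistency says that all maximal minors
    of [[I | x_(r+1) x_(r+2) ...]] are nonnegative.  For the signed and reversed
    coordinates [w_k(i)] this gives [w_k(i) >= 0] and
    [w_k(j) w_(k+1)(i) <= w_k(i) w_(k+1)(j)] for [i < j].  The companion form of
    [A] reads [w_(k+1)(i) = w_1(i) w_k(0) - w_k(i+1)], and eliminating
    [w_k(i+1)] and [w_(k+1)(i+1)] with it turns [w_(k+1)(i)^2 - w_k(i) w_(k+2)(i)]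
    into the sum of the 2-minor on rows [i, i+1] and [w_1(i)] times the 2-minor
    on rows [0, i].  Summing the recurrence over [i] gives
    [p_(k+1) = c w_k(0) - p_k], and the same elimination applies to [p]. *)

Require Import Defs.
From mathcomp Require Import all_boot all_order all_algebra perm reals.
From mathcomp Require Import zify ring lra.

Set Implicit Arguments.
Unset Strict Implicit.
Unset Printing Implicit Defensive.

Import Order.TTheory GRing.Theory Num.Theory.
Local Open Scope ring_scope.

(** * Determinants of the identity with one or two columns replaced *)

(** Both sides are the determinant of one block matrix, factored in two block triangular ways. This
    reduces a low-rank update of the identity to a determinant of size 1 or 2. *)
Lemma det_sylvester (R : comNzRingType) (m n : nat) (P : 'M[R]_(m, n))
    (Q : 'M[R]_(n, m)) :
  \det (1%:M + P *m Q) = \det (1%:M + Q *m P).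
Proof.
have E1 : block_mx 1%:M (- P) Q 1%:M =
    block_mx 1%:M 0 Q 1%:M *m block_mx 1%:M (- P) 0 (1%:M + Q *m P).
  by rewrite mulmx_block !(mul1mx, mulmx1, mul0mx, mulmx0, addr0) mulmxN addrCA addNr
             addr0.
have E2 : block_mx 1%:M (- P) Q 1%:M =
    block_mx 1%:M (- P) 0 1%:M *m block_mx (1%:M + P *m Q) 0 Q 1%:M.
  by rewrite mulmx_block !(mul1mx, mulmx1, mul0mx, mulmx0, addr0, add0r) mulNmx addrK.
have := congr1 determinant E1; rewrite E2 !det_mulmx !det_lblock !det_ublock.
by rewrite !det1 !mul1r !mulr1.
Qed.

Lemma mul_delta_row (R : comNzRingType) (n : nat) (c : 'I_n) (z : 'cV[R]_n) :
  delta_mx (0 : 'I_1) c *m z = (z c 0)%:M.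
Proof. by rewrite -rowE [LHS]mx11_scalar mxE. Qed.

Lemma det_id_col1 (R : comNzRingType) (n : nat) (a : 'I_n) (x : 'cV[R]_n) :
  \det (\matrix_(i < n, t < n) if t == a then x i 0 else (i == t)%:R) = x a 0.
Proof.
(* Replacing column [a] by [x] is a rank-one update. *)
transitivity (\det (1%:M + (x - delta_mx a 0) *m delta_mx (0 : 'I_1) a)).
  congr determinant; apply/matrixP => i t; rewrite !mxE big_ord1 !mxE eqxx andbT /=.
  by case: eqP => [->|_]; rewrite ?mulr1 ?mulr0 ?addr0 // addrC subrK.
rewrite det_sylvester mul_delta_row det_mx11 !mxE !eqxx /= !mulr1n.
by rewrite addrC subrK.
Qed.

Lemma det_mx22 (R : comNzRingType) (M : 'M[R]_(1 + 1)) :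
  let i := lshift 1 0 in let j := rshift 1 0 in
  \det M = M i i * M j j - M j i * M i j.
Proof.
move=> i j; rewrite (expand_det_col _ i) big_split_ord !big_ord1 /cofactor.
rewrite !det_mx11 !mxE /= expr0 expr1 mul1r mulN1r mulrN.
by congr (_ * M _ _ - M _ _ * M _ _); apply/val_inj.
Qed.

Lemma det_id_col2 (R : comNzRingType) (n : nat) (a b : 'I_n) (x y : 'cV[R]_n) :
  a != b ->
  \det (\matrix_(i < n, t < n)
          if t == a then x i 0 else if t == b then y i 0 else (i == t)%:R) =
  x a 0 * y b 0 - x b 0 * y a 0.
Proof.
move=> a_b.
transitivity (\det (1%:M + row_mx (x - delta_mx a 0) (y - delta_mx b 0) *m
    col_mx (delta_mx (0 : 'I_1) a) (delta_mx (0 : 'I_1) b))).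
  congr determinant; apply/matrixP => i t.
  rewrite mul_row_col !mxE !big_ord1 !mxE !eqxx !andbT /=.
  case: eqP => [->|_]; first by rewrite (negPf a_b) mulr1 mulr0 addr0 addrC subrK.
  by case: eqP => [->|_]; rewrite ?mulr1 ?mulr0 ?addr0 // add0r addrC subrK.
rewrite det_sylvester mul_col_row !mul_delta_row (@scalar_mx_block _ 1 1) add_block_mx.
rewrite det_mx22.
rewrite block_mxEul block_mxEur block_mxEdl block_mxEdr !mxE !eqxx.
rewrite (negPf a_b) (eq_sym b) (negPf a_b) /= !mulr1n.
by rewrite !subr0 !add0r !(addrC 1) !subrK.
Qed.

(** * Entries and 2-minors of the coordinates as maximal minors *)

(** The sign can be fixed as nonnegative because the first [r] columns will form the identity, with
    minor 1. *)
Definition nonneg_minors (R : realFieldType) (r : nat) (x : nat -> 'cV[R]_r) :=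
  forall J : 'I_r -> nat, (forall s t : 'I_r, (s < t)%N -> (J s < J t)%N) ->
  0 <= \det (\matrix_(i, t) x (J t) i 0).

(** The sign is that of the cycle moving the last column to position [a]. *)
Lemma nonneg_minor1 (R : realFieldType) (n : nat) (x : nat -> 'cV[R]_n.+1) :
  (forall t : 'I_n.+1, x t = delta_mx t 0) -> nonneg_minors x ->
  forall (a : 'I_n.+1) (q : nat), (n < q)%N -> 0 <= (-1) ^+ (n - a) * x q a 0.
Proof.
move=> x_unit x_minor a q n_q.
(* The unit columns except [a], in order, then column [q]. *)
pose J (t : 'I_n.+1) := if (t : nat) == n then q else bump a t.
have /(x_minor J) : forall s t : 'I_n.+1, (s < t)%N -> (J s < J t)%N.
  move=> i j ij; rewrite /J /bump; have := ltn_ord j; have := ltn_ord i.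
  by do ?case: eqP; lia.
pose s := lift_perm ord_max a 1%g.
pose N : 'M[R]_n.+1 := \matrix_(i, t) if t == a then x q i 0 else (i == t)%:R.
have -> : \matrix_(i, t) x (J t) i 0 = col_perm s N.
  apply/matrixP => i t; rewrite !mxE /J.
  case: (unliftP ord_max t) => [t'|] ->; last by rewrite lift_perm_id !eqxx.
  rewrite lift_perm_lift perm1 [_ == a]eq_sym (negPf (neq_lift _ _)) lift_max ltn_eqF //.
  by rewrite -[bump a t']/(nat_of_ord (lift a t')) x_unit mxE eqxx andbT.
rewrite col_permE det_mulmx det_perm det_id_col1 odd_permV odd_lift_perm odd_perm1.
by rewrite addbF -oddB /= ?signr_odd 1?mulrC // -ltnS.
Qed.

(** Dropping the unit columns [a], [b] and appending columns [p], [q] leaves a maximal minor equal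
    to this 2-minor up to the sign of two column cycles. *)
Lemma nonneg_minor2 (R : realFieldType) (n : nat) (x : nat -> 'cV[R]_n.+1) :
  (forall t : 'I_n.+1, x t = delta_mx t 0) -> nonneg_minors x ->
  forall (a b : 'I_n.+1) (p q : nat), (a < b)%N -> (n < p < q)%N ->
  0 <= (-1) ^+ (a + b).+1 * (x p a 0 * x q b 0 - x p b 0 * x q a 0).
Proof.
case: n x => [|n] x x_unit x_minor a b p q a_b /andP[n_p p_q].
  by move: a_b; rewrite !ord1.
have a_n : (a < n.+1)%N by have := ltn_ord b; lia.
pose a' : 'I_n.+1 := Ordinal a_n.
have aE : a = lift b a' by apply/val_inj; rewrite /= /bump leqNgt a_b.
have a_neq_b : a != b by rewrite aE eq_sym neq_lift.
pose J (t : 'I_n.+2) :=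
  if (t : nat) == n.+1 then q else if (t : nat) == n then p else bump b (bump a t).
have /(x_minor J) : forall s t : 'I_n.+2, (s < t)%N -> (J s < J t)%N.
  move=> i j ij; rewrite /J /bump; have := ltn_ord j; have := ltn_ord i.
  by do ?case: eqP; lia.
(* The last column goes to position [b], the one before it to [a]: [n.+1 - b] and [n - a]
   transpositions. *)
pose s := lift_perm ord_max b (lift_perm ord_max a' 1%g).
pose N : 'M[R]_n.+2 :=
  \matrix_(i, t) if t == a then x p i 0 else if t == b then x q i 0 else (i == t)%:R.
have -> : \matrix_(i, t) x (J t) i 0 = col_perm s N.
  apply/matrixP => i t; rewrite !mxE /J.
  case: (unliftP ord_max t) => [t1|] ->.
    rewrite lift_perm_lift lift_max ltn_eqF //.
    case: (unliftP ord_max t1) => [t2|] ->.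
      rewrite lift_perm_lift perm1 lift_max ltn_eqF //.
      rewrite (negPf (_ : _ != a)); last by rewrite aE (inj_eq lift_inj) eq_sym neq_lift.
      rewrite [_ == b]eq_sym (negPf (neq_lift _ _)).
      rewrite -[bump b _]/(nat_of_ord (lift b (lift a' t2))).
      by rewrite x_unit mxE eqxx andbT.
    by rewrite lift_perm_id -aE !eqxx.
  by rewrite lift_perm_id !eqxx eq_sym (negPf a_neq_b).
rewrite col_permE det_mulmx det_perm det_id_col2 // odd_permV !odd_lift_perm odd_perm1.
rewrite mulrC -(signr_odd _ (_ + _).+1) /= oddD.
by case: (odd a); case: (odd b); case: (odd n).
Qed.

(** * Log-concavity from the recurrence and the 2-minors *)

(** The row [n.+1] is the zero row, which closes the recurrence at [i = n]. *)
Lemma hook_log_concave (R : realFieldType) (n : nat) (w : nat -> nat -> R) :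
  (forall k, w k n.+1 = 0) ->
  (forall k i, (i <= n)%N -> w k.+1 i = w 1 i * w k 0 - w k i.+1) ->
  (forall k i, (0 < k)%N -> (i <= n)%N -> 0 <= w k i) ->
  (forall k i j, (0 < k)%N -> (i < j <= n)%N -> w k j * w k.+1 i <= w k i * w k.+1 j) ->
  (forall i, (i <= n)%N -> log_concave (w^~ i)) /\
  log_concave (fun k => \sum_(i < n.+1) w k i).
Proof.
move=> w_n w_rec w_ge0 w_minor.
(* The added cases [i = j] and [j = n.+1] are equalities. *)
have minor k i j : (0 < k)%N -> (i <= j <= n.+1)%N ->
    w k j * w k.+1 i <= w k i * w k.+1 j.
  move=> k0 /andP[]; rewrite leq_eqVlt => /orP[/eqP->|ij]; first by rewrite mulrC.
  rewrite leq_eqVlt => /orP[/eqP->|jn]; first by rewrite !w_n mul0r mulr0.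
  by apply: w_minor; rewrite // ij.
split=> [i i_n|].
  split=> k k0; first exact: w_ge0.
  have w0 : 0 <= w 1 i by apply: w_ge0.
  have := minor k 0 i k0; have := minor k i i.+1 k0.
  rewrite leq0n leqnSn (leqW i_n) ltnS i_n => /(_ isT) m1 /(_ isT) m2.
  rewrite (w_rec k.+1) //.
  have E : w k i.+1 = w 1 i * w k 0 - w k.+1 i by rewrite (w_rec k) //; ring.
  rewrite E in m1; have := mulr_ge0 w0 (_ : 0 <= w k 0 * w k.+1 i - w k i * w k.+1 0).
  by rewrite subr_ge0 => /(_ m2); nra.
split=> k k0; first by apply: sumr_ge0 => i _; apply: w_ge0; rewrite // -[(_ <= _)%N]ltnS.
pose p l := \sum_(i < n.+1) w l i; rewrite -!/(p _); pose c := 1 + \sum_(i < n.+1) w 1 i.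
(* The shifted sum of [w l i.+1] is [p l - w l 0], hence the 1 in [c]. *)
have p_rec l : p l.+1 = c * w l 0 - p l.
  have -> : p l = w l 0 + \sum_(i < n.+1) w l i.+1.
    rewrite /p big_ord_recl; congr (_ + _).
    by rewrite [RHS]big_ord_recr /= w_n addr0.
  rewrite /p (eq_bigr (fun i : 'I_n.+1 => w 1 i * w l 0 - w l i.+1)) => [|i _].
    by rewrite big_split /= -mulr_suml sumrN /c; ring.
  by rewrite (w_rec l) // -ltnS.
have c0 : 0 <= c.
  by rewrite addr_ge0 // sumr_ge0 // => i _; apply: w_ge0; rewrite // -[(_ <= _)%N]ltnS.
have pm : p k * w k.+1 0 <= w k 0 * p k.+1.
  rewrite mulr_suml mulr_sumr; apply: ler_sum => i _.
  by apply: minor; rewrite // leq0n ltnW.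
(* After both substitutions [p k.+1 ^+ 2 - p k * p k.+2] is [c] times the slack in [pm]. *)
rewrite (p_rec k.+1); have E : p k.+1 = c * w k 0 - p k by apply: p_rec.
have := mulr_ge0 c0 (_ : 0 <= w k 0 * p k.+1 - p k * w k.+1 0).
by rewrite subr_ge0 => /(_ pm); nra.
Qed.

(** * The first [r] columns as a basis *)

Lemma ctrb_recr (R : realFieldType) (m : nat) (A : 'M[R]_m) (b : 'cV[R]_m) (j : nat) :
  ctrb A b j.+1 = A *m ctrb A b j.
Proof. by rewrite /ctrb mulmxA; case: m A b => [|m] A b; rewrite ?exprS // !thinmx0. Qed.

(** [A] maps each generator to the next and the last one to [ctrb A b d], so the span is
    [A]-invariant. *)
Lemma ctrb_span_stable (R : realFieldType) (m d : nat) (A : 'M[R]_m) (b : 'cV[R]_m) :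
  let U := <<mkseq (ctrb A b) d>>%VS in
  ctrb A b d \in U -> forall j, ctrb A b j \in U.
Proof.
move=> U Ud; elim=> [|j IHj].
  by case: d @U Ud => // d U _; apply/memv_span/map_f; rewrite mem_iota.
have AU v : v \in U -> A *m v \in U.
  move=> /(@coord_span _ _ _ (in_tuple _)) ->; rewrite mulmx_sumr.
  apply: memv_suml => i _; rewrite -scalemxAr; apply: memvZ.
  have i_d : (i < d)%N by rewrite -[d in (_ < d)%N](size_mkseq (ctrb A b)).
  rewrite nth_mkseq // -ctrb_recr.
  have [->|i1_d] := eqVneq i.+1 d; first by [].
  by apply/memv_span/map_f; rewrite mem_iota add0n ltn_neqAle i1_d i_d.
by rewrite ctrb_recr AU.
Qed.

(** If column [d < r] depended on its predecessors, all columns would lie in a span of dimension at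
    most [d]. *)
Lemma ctrb_basis (R : realFieldType) (m r : nat) (A : 'M[R]_m) (b : 'cV[R]_m) :
  infrank_eq (ctrb A b) r ->
  free (mkseq (ctrb A b) r) /\ forall j, ctrb A b j \in <<mkseq (ctrb A b) r>>%VS.
Proof.
move=> [U [VU Umin dimU]].
have notin d : (d < r)%N -> ctrb A b d \notin <<mkseq (ctrb A b) d>>%VS.
  rewrite ltnNge; apply: contra => /ctrb_span_stable/Umin/dimvS.
  by rewrite dimU => /leq_trans; apply; rewrite -{2}(size_mkseq (ctrb A b) d) dim_span.
have freeV : free (mkseq (ctrb A b) r).
  elim: {1 3}r (leqnn r) => [|d IHd] d_r; first exact: nil_free.
  rewrite mkseqS (perm_free (Y := ctrb A b d :: mkseq (ctrb A b) d)) ?perm_rcons //.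
  by rewrite free_cons notin // IHd // ltnW.
split=> // j; suff -> : <<mkseq (ctrb A b) r>>%VS = U by [].
apply/eqP; rewrite eqEdim dimU.
move: freeV; rewrite /free => /eqP ->; rewrite size_mkseq leqnn andbT.
by apply/span_subvP => v /mapP[i _ ->].
Qed.

Lemma mulmx_first_cols (R : realFieldType) (m r : nat) (V : infmx R m) (c : 'cV[R]_r) :
  first_cols r V *m c = \sum_(t < r) c t 0 *: V t.
Proof.
apply/colP => i; rewrite mxE summxE; apply: eq_bigr => t _.
by rewrite !mxE mulrC.
Qed.

(** The first [r] columns are independent, so [X] can be cancelled from the first Penrose equation.
    Hence [mppinv X] computes coordinates in that basis. *)
Lemma ctrb_mppinvK (R : realFieldType) (m r : nat) (A : 'M[R]_m) (b : 'cV[R]_m) :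
  infrank_eq (ctrb A b) r ->
  let X := first_cols r (ctrb A b) in
  mppinv X *m X = 1%:M /\ forall j, X *m (mppinv X *m ctrb A b j) = ctrb A b j.
Proof.
move=> /ctrb_basis[freeV spanV] X.
have /and4P[/eqP XYX _ _ _] := mppinvP X.
have sizeV : size (mkseq (ctrb A b) r) == r by rewrite size_mkseq.
have Xinj (c : 'cV[R]_r) : X *m c = 0 -> c = 0.
  rewrite mulmx_first_cols => c0; apply/colP => i; rewrite mxE.
  have /freeP := (freeV : free (Tuple sizeV)).
  move=> /(_ (fun t => c t 0)) -> //; rewrite -[RHS]c0.
  by apply: eq_bigr => t _; rewrite nth_mkseq.
split=> [|j].
  apply/eqP; rewrite -subr_eq0; apply/eqP/trmx_inj/row_matrixP => i.
  rewrite trmx0 row0 -tr_col (Xinj (col i _)) ?trmx0 // colE mulmxA mulmxBr mulmxA.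
  by rewrite XYX mulmx1 subrr mul0mx.
have [c <-] : exists c, X *m c = ctrb A b j.
  have := @coord_span _ _ _ (Tuple sizeV) _ (spanV j).
  move=> VE; exists (\col_i coord (Tuple sizeV) i (ctrb A b j)).
  rewrite mulmx_first_cols [RHS]VE; apply: eq_bigr => t _.
  by rewrite mxE nth_mkseq.
by rewrite !mulmxA XYX.
Qed.

(** * Sign consistency in coordinates *)

(** [fullrankfun] selects independent rows without a prescribed order; enumerating its image sorts
    them and keeps the row space. *)
Lemma increasing_unit_rows (F : fieldType) (m r : nat) (X : 'M[F]_(m, r)) :
  row_full X ->
  exists f : 'I_r -> 'I_m, increasing_ord f /\ rowsub f X \in unitmx.
Proof.
move=> fullX; have := fullrowsub_unit fullX; set h := fullrankfun _ => h_unit.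
pose S := [set h i | i : 'I_r].
have cardS : #|S| = r by rewrite card_imset ?card_ord //; apply: fullrankfun_inj.
pose f (i : 'I_r) : 'I_m := enum_val (cast_ord (esym cardS) i).
exists f; split=> [i j i_j|].
  have sorted_S : sorted ltn (map val (enum S)).
    apply: (@subseq_sorted _ _ ltn_trans _ (iota 0 m)); last exact: iota_ltn_sorted.
    by rewrite -val_enum_ord; apply: map_subseq; rewrite enumT; apply: filter_subseq.
  have sizeS : size (enum S) = r by rewrite -cardE.
  rewrite /f !(enum_val_nth (h i)) -!(nth_map (h i) 0%N val) ?sizeS //=.
  by apply: (sorted_ltn_nth ltn_trans); rewrite ?inE ?size_map ?sizeS.
rewrite -row_full_unit -sub1mx; move: h_unit; rewrite -row_full_unit -sub1mx.
move=> /submx_trans; apply; apply/row_subP => i.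
have hS : h i \in S by apply: imset_f.
have -> : row i (rowsub h X) = row (cast_ord cardS (enum_rank_in hS (h i))) (rowsub f X).
  by rewrite !row_rowsub /f cast_ordK enum_rankK_in.
exact: row_sub.
Qed.

(** Every minor of [V] on rows [f] is [\det (rowsub f X)] times a coordinate minor. The first [r]
    columns show that this factor has the common sign, so it cancels. *)
Lemma sign_consistent_coord (R : realFieldType) (m r : nat) (V : infmx R m)
    (Y : 'M[R]_(r, m)) :
  Y *m first_cols r V = 1%:M ->
  (forall j, first_cols r V *m (Y *m V j) = V j) ->
  inf_sign_consistent r V -> nonneg_minors (fun j => Y *m V j).
Proof.
set X := first_cols r V => YX XY scV J J_incr.
have /increasing_unit_rows[f [f_incr f_unit]] : row_full X by apply/row_fullP; exists Y.
(* Wide enough for the first [r] columns and all columns [J t]. *)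
pose N := (r + (\max_(t < r) J t).+1)%N.
have N_gt (t : 'I_r) : (J t < N)%N.
  by rewrite /N addnS ltnS (leq_trans (leq_bigmax t)) ?leq_addl.
pose g t : 'I_N := Ordinal (N_gt t).
pose g0 : 'I_r -> 'I_N := lshift _.
have subE (h : 'I_r -> 'I_N) : mxsub f h (first_cols N V) =
    rowsub f X *m \matrix_(i, t) (Y *m V (h t)) i 0.
  apply/matrixP => i t; rewrite !mxE -{1}XY mxE.
  by apply: eq_bigr => k _; rewrite !mxE.
have det0 : \det (mxsub f g0 (first_cols N V)) = \det (rowsub f X).
  congr determinant; apply/matrixP => i t; rewrite !mxE //.
have detg : \det (mxsub f g (first_cols N V)) =
    \det (rowsub f X) * \det (\matrix_(i, t) (Y *m V (J t)) i 0).
  by rewrite subE det_mulmx.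
have g0_incr : increasing_ord g0 by [].
have d_neq0 : \det (rowsub f X) != 0 by rewrite -unitfE -unitmxE.
case: (scV N (leq_addr _ _)) => sc; have := sc f g f_incr J_incr;
  have := sc f g0 f_incr g0_incr; rewrite det0 detg;
  rewrite le_eqVlt ?[0 == _]eq_sym (negPf d_neq0) /= => d0.
  by rewrite pmulr_rge0.
by rewrite nmulr_rle0.
Qed.

(** * Companion recurrence and signed reversed coordinates *)

(** Applying [A] to the basis expansion of column [j] shifts each basis vector. *)
Lemma ctrb_coord_recr (R : realFieldType) (m r : nat) (A : 'M[R]_m) (b : 'cV[R]_m) :
  infrank_eq (ctrb A b) r ->
  let x j := mppinv (first_cols r (ctrb A b)) *m ctrb A b j in
  forall j, x j.+1 = \sum_(t < r) x j t 0 *: x t.+1.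
Proof.
move=> /ctrb_mppinvK[_ XK] x j.
rewrite {1}/x ctrb_recr -{1}XK mulmx_first_cols !mulmx_sumr.
by apply: eq_bigr => t _; rewrite -!scalemxAr -ctrb_recr.
Qed.

Lemma Kmx_tr_mul (R : realFieldType) (n : nat) (y : 'cV[R]_n) (i : 'I_n) :
  ((Kmx R n)^T *m y) i 0 = (-1) ^+ i * y (rev_ord i) 0.
Proof.
rewrite mxE (bigD1 (rev_ord i)) //= !mxE /= big1 => [|j j_i].
  by rewrite addr0 ifT // -addnS subnK.
rewrite !mxE ifF ?mul0r //; apply: contraNF j_i => /eqP j_i.
by apply/eqP/val_inj; rewrite /= -{2}j_i -addnS addnK.
Qed.

Theorem theorem3 (R : realType) (m r : nat) (A : 'M[R]_m) (b : 'cV[R]_m) :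
  let V : infmx R m := ctrb A b in
  let x (k : nat) : 'cV[R]_r := mppinv (first_cols r V) *m V (r + k).-1 in
  let W (k : nat) : 'cV[R]_r := (Kmx R r)^T *m x k in
  let g (i : 'I_r) (k : nat) : R := ((W k)^T *m (delta_mx i 0 : 'cV[R]_r)) 0 0 in
  let p (k : nat) : R := \sum_(i < r) g i k in
  infrank_eq V r ->
  inf_sign_consistent r V ->
  [/\ forall i : 'I_r, log_concave (g i),
      log_concave p,
      forall k : nat, (1 <= k)%N ->
        p k = ((W k)^T *m (const_mx 1 : 'cV[R]_r)) 0 0
    & forall k : nat, (1 <= k)%N -> p k = l1norm (x k)].
Proof.
move=> V x W g p rankV scV.
have gE i k : g i k = (-1) ^+ i * x k (rev_ord i) 0.
  by rewrite /g -colE mxE mxE Kmx_tr_mul.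
have pE k : p k = ((W k)^T *m (const_mx 1 : 'cV[R]_r)) 0 0.
  rewrite mxE; apply: eq_bigr => i _.
  by rewrite gE -Kmx_tr_mul [const_mx _ _ _]mxE mulr1 [RHS]mxE.
case: r @x @W @g @p rankV scV gE pE => [|n] x W g p rankV scV gE pE.
  have p0 k : p k = 0 by rewrite /p big_ord0.
  split=> //; first by case.
    by split=> k _; rewrite !p0 // mul0r expr0n.
  by move=> k _; rewrite p0 /l1norm big_ord0.
have [YX XY] := ctrb_mppinvK rankV.
have y_minor := sign_consistent_coord YX XY scV.
set y := fun j => _ in y_minor.
have y_recr j : y j.+1 = \sum_(t < n.+1) y j t 0 *: y t.+1 by exact: ctrb_coord_recr.
have y_unit (t : 'I_n.+1) : y t = delta_mx t 0.
  rewrite -[RHS]mul1mx -YX -mulmxA -colE; congr (_ *m _).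
  by apply/colP => i; rewrite !mxE.
have xE k : x k = y (n + k)%N by [].
clearbody y.
(* [g] extended by zero rows beyond [n] and by [k = 0], the last unit column. *)
pose w k i := if (i <= n)%N then (-1) ^+ i * y (n + k)%N (inord (n - i)) 0 else 0.
have wE k (i : 'I_n.+1) : w k i = g i k.
  rewrite gE xE /w -ltnS ltn_ord; congr (_ * y _ _ _).
  by apply/val_inj; rewrite /= inordK // ltnS leq_subr.
have w_ge0 k i : (0 < k)%N -> (i <= n)%N -> 0 <= w k i.
  move=> k0 i_n; rewrite /w i_n.
  (* At row [n - i] the sign exponent is [n - (n - i) = i], as in [Kmx]. *)
  have := nonneg_minor1 y_unit y_minor (inord (n - i)) (_ : n < n + k)%N.
  by rewrite inordK ?ltnS ?leq_subr // subKn // => -> //; rewrite -addn1 leq_add2l.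
have [||||gC pC] := @hook_log_concave R n w.
- by move=> k; rewrite /w ltnn.
- move=> k i i_n; rewrite /w leq0n subn0 i_n addn1 addnS y_recr.
  (* The summand [t = n] gives [w 1 i * w k 0]. In the others [y t.+1] is a unit column, so only
     [t = n - i - 1] survives and gives [- w k i.+1]; for [i = n] none does, matching the zero
     row. *)
  rewrite big_ord_recr /= mxE summxE.
  have -> : inord n = ord_max :> 'I_n.+1 by apply/val_inj; rewrite /= inordK.
  rewrite expr0 mul1r mxE mulrDr addrC; congr (_ + _); first by rewrite mulrCA mulrC.
  have term (t : 'I_n) :
      (y (n + k)%N (widen_ord (leqnSn n) t) 0 *: y t.+1) (inord (n - i)) 0 =
      y (n + k)%N (widen_ord (leqnSn n) t) 0 * ((n - i)%N == t.+1)%:R.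
    rewrite mxE (y_unit (lift ord0 t)) mxE eqxx andbT; congr (_ * _%:R).
    by rewrite -val_eqE /= inordK // ltnS leq_subr.
  rewrite (eq_bigr _ (fun t _ => term t)).
  case: ltnP => [i_lt_n|n_i]; last first.
    rewrite big1 ?mulr0 ?oppr0 // => t _.
    by rewrite (_ : (n - i = 0)%N) ?mulr0 //; apply/eqP; rewrite subn_eq0.
  have t_n : (n - i.+1 < n)%N by lia.
  rewrite (bigD1 (Ordinal t_n)) //= big1 => [|t t_neq].
    rewrite addr0 subnSK // eqxx mulr1 exprS mulN1r mulNr opprK.
    by congr (_ * y _ _ _); apply/val_inj; rewrite /= inordK //; lia.
  rewrite (_ : _ == _ = false) ?mulr0 //; apply: contraNF t_neq => /eqP ni.
  by apply/eqP/val_inj => /=; lia.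
- exact: w_ge0.
- move=> k i j k0 /andP[i_j j_n]; have i_n := leq_trans (ltnW i_j) j_n.
  have := nonneg_minor2 y_unit y_minor (a := inord (n - j)) (b := inord (n - i))
    (p := (n + k)%N) (q := (n + k.+1)%N).
  rewrite !inordK ?ltnS ?leq_subr // => /(_ _ _).
  (* The extra minus sign undoes the reversal of the two rows. *)
  have -> : (-1) ^+ (n - j + (n - i)).+1 = - ((-1) ^+ i * (-1) ^+ j) :> R.
    rewrite exprS mulN1r -exprD -signr_odd -[in RHS]signr_odd !oddD !oddB //.
    by case: (odd i); case: (odd j); case: (odd n).
  rewrite /w i_n j_n => H; rewrite -subr_ge0.
  set e := (-1) ^+ i in H *; set f := (-1) ^+ j in H *.
  have := H (ltac:(lia)) (ltac:(lia)); lra.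
split=> //.
- move=> i; have [g0 g2] := gC i (ltn_ord i : i <= n)%N.
  by split=> k k0; rewrite -!wE; [apply: g0 | apply: g2].
- have pw k : p k = \sum_(i < n.+1) w k i by apply: eq_bigr => i _; rewrite wE.
  have [p0 p2] := pC.
  by split=> k k0; rewrite !pw; [apply: p0 | apply: p2].
(* Each [g i k] is nonnegative, hence the absolute value of a coordinate of [x k], in reversed
   order. *)
move=> k k0; rewrite /l1norm (reindex_inj rev_ord_inj); apply: eq_bigr => i _.
have := w_ge0 k i k0; rewrite wE -ltnS ltn_ord => /(_ isT) /ger0_norm <-.
by rewrite gE normrMsign.
Qed.
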